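(* For all $n\ge2$, we have $c_n(123,213,231)=4(n-1)$.
   Context: A word $\pi=\pi_1\dots\pi_m$ over the positive integers contains the pattern $\sigma=\sigma_1\dots\sigma_k$ if there are indices $1\le i_1<\dots<i_k\le m$ such that for all $r,s\in\{1,\dots,k\}$: $\pi_{i_r}<\pi_{i_s}$ iff $\sigma_r<\sigma_s$, and $\pi_{i_r}=\pi_{i_s}$ iff $\sigma_r=\sigma_s$; otherwise $\pi$ avoids $\sigma$. $\mathcal{C}_n$ denotes the set of nonnesting permutations: arrangements (words) of the multiset $\{1,1,2,2,\dots,n,n\}$ that avoid the patterns $1221$ and $2112$. For patterns $\sigma,\tau,\dots$, $c_n(\sigma,\tau,\dots)$ is the number of $\pi\in\mathcal{C}_n$ avoiding all of $\sigma,\tau,\dots$. *)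

(* Defs.v *)
From mathcomp Require Import all_boot.

Set Implicit Arguments.
Unset Strict Implicit.
Unset Printing Implicit Defensive.

(* Positions are counted from 0, so f is the (strictly increasing) choice of
   positions i_1 < ... < i_k, and sigma_r, pi_(i_r) are nth 0 sigma r and
   nth 0 w (f r); the default 0 is never reached. *)
Definition contains (w sigma : seq nat) : bool :=
  [exists f : {ffun 'I_(size sigma) -> 'I_(size w)},
     [forall r : 'I_(size sigma), forall s : 'I_(size sigma),
        (r < s) ==> (f r < f s)] &&
     [forall r : 'I_(size sigma), forall s : 'I_(size sigma),
        ((nth 0 w (f r) < nth 0 w (f s)) == (nth 0 sigma r < nth 0 sigma s)) &&
        ((nth 0 w (f r) == nth 0 w (f s)) ==
           (nth 0 sigma r == nth 0 sigma s))]].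

Definition avoids (w sigma : seq nat) : bool := ~~ contains w sigma.

Definition doubled (n : nat) : seq nat :=
  flatten [seq [:: i; i] | i <- iota 1 n].

(* [permutations s] lists the distinct rearrangements of s without repetition
   (permutations_uniq, mem_permutations), so sizes below count words. *)
Definition nonnesting (n : nat) : seq (seq nat) :=
  [seq w <- permutations (doubled n) |
     avoids w [:: 1; 2; 2; 1] && avoids w [:: 2; 1; 1; 2]].

Definition c (n : nat) (patterns : seq (seq nat)) : nat :=
  size [seq w <- nonnesting n | all (avoids w) patterns].

(* Main.v *)
Require Import Defs.
From mathcomp Require Import all_boot.
From mathcomp Require Import zify.

(** Write n = m + 1. Deleting the two 1s from a word w counted here leaves a
    word over the larger letters, and avoiding 123, 213 and 231 says exactly
    that this remainder is weakly decreasing. Indeed, if x < y are letters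
    above 1 and x stands before y, then a 1, wherever it is, completes the pair
    to 1xy, x1y or xy1, which are occurrences of 123, 213 and 231; conversely,
    in each of these three patterns the two letters other than the minimum form
    an ascent above 1 ([avoids_three_sorted]). Hence w is the word
    D = nn...3322 with two 1s inserted.

    It remains to decide where the 1s may go. Write w = A 1 B 1 C with
    D = A B C. As D is decreasing, an occurrence of 1221 or 2112 must use 1 as
    its smaller letter, so that 1221 means that B repeats a letter, and 2112
    that A and C share a letter ([avoids_nesting]). With a = size A and
    l = size B, and since the letters of D come in adjacent equal pairs, both
    are avoided if and only if l = 0 and a is even, or l = 1, or l = 2 and a is
    odd. In the range a + l <= 2m these cases contribute m + 1, 2m and m - 1
    words, and m + 1 + 2m + (m - 1) = 4m. *)

Set Implicit Arguments.
Unset Strict Implicit.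
Unset Printing Implicit Defensive.

(** * Pattern containment through subsequences *)

(** Ranging over [iota] rather than over ordinals lets the predicate compute to
    finitely many comparisons when [t] and [sigma] are explicit. *)
Definition order_iso (t sigma : seq nat) : bool :=
  (size t == size sigma) &&
  all (fun r => all (fun s =>
    ((nth 0 t r < nth 0 t s) == (nth 0 sigma r < nth 0 sigma s)) &&
    ((nth 0 t r == nth 0 t s) == (nth 0 sigma r == nth 0 sigma s)))
    (iota 0 (size sigma))) (iota 0 (size sigma)).

(** Both [s] and the sublist of [iota 0 n] of members of [s] are strictly
    increasing lists with the same elements, hence equal. *)
Lemma sorted_ltn_subseq_iota n s :
  sorted ltn s -> all (gtn n) s -> subseq s (iota 0 n).
Proof.
move=> s_sorted /allP s_lt.
have -> : s = [seq i <- iota 0 n | i \in s].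
  apply: (irr_sorted_eq ltn_trans ltnn) => // [|i].
    by rewrite sorted_filter ?iota_ltn_sorted //; apply: ltn_trans.
  rewrite mem_filter mem_iota /= add0n.
  by case s_i: (i \in s) => //=; move/s_lt: s_i => /= ->.
exact: filter_subseq.
Qed.

(** The choice of positions in the definition of [contains] is a strictly
    increasing list of indices, that is, a sublist of [iota 0 (size w)]; mapping
    it through [nth 0 w] turns it into a subsequence of [w], and back. *)
Lemma containsP w sigma :
  reflect (exists2 t, subseq t w & order_iso t sigma) (contains w sigma).
Proof.
apply: (iffP existsP) => [[f /andP[/forallP f_mono /forallP f_iso]] | ].
- pose t := [seq nth 0 w (f r) | r <- enum 'I_(size sigma)].
  have nth_t r (hr : r < size sigma) : nth 0 t r = nth 0 w (f (Ordinal hr)).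
    rewrite (nth_map (Ordinal hr)) ?size_enum_ord //; congr (nth 0 w (f _)).
    by apply: val_inj; rewrite /= nth_enum_ord.
  exists t.
    have -> : t = [seq nth 0 w i | i <- [seq val (f r) | r <- enum 'I_(size sigma)]].
      by rewrite -map_comp.
    rewrite -[w in subseq _ w](mkseq_nth 0) /mkseq; apply: map_subseq.
    apply: sorted_ltn_subseq_iota; last by apply/allP => _ /mapP[r _ ->] /=.
    have := iota_ltn_sorted 0 (size sigma).
    rewrite -val_enum_ord !sorted_map; apply: sub_sorted => r s /= lt_rs.
    exact: (implyP (forallP (f_mono r) s)).
  rewrite /order_iso size_map size_enum_ord eqxx /=.
  apply/allP => r; rewrite mem_iota /= add0n => hr.
  apply/allP => s; rewrite mem_iota /= add0n => hs.
  rewrite !nth_t; exact: (forallP (f_iso (Ordinal hr)) (Ordinal hs)).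
- case=> t /subseqP[b size_b def_t] /andP[/eqP size_t /allP iso_t].
  pose p := mask b (iota 0 (size w)).
  have def_tp : t = [seq nth 0 w i | i <- p].
    by rewrite /p map_mask -/(mkseq _ _) mkseq_nth.
  have size_p : size p = size sigma by rewrite -size_t def_tp size_map.
  have p_sub : subseq p (iota 0 (size w)) by exact: mask_subseq.
  have p_sorted : sorted ltn p.
    exact: (subseq_sorted ltn_trans p_sub (iota_ltn_sorted _ _)).
  have p_lt (r : 'I_(size sigma)) : nth 0 p r < size w.
    have := mem_subseq p_sub (mem_nth 0 (_ : r < size p)).
    by rewrite mem_iota size_p => /(_ (ltn_ord r)).
  have nth_t (r : 'I_(size sigma)) : nth 0 t r = nth 0 w (nth 0 p r).
    by rewrite def_tp (nth_map 0) ?size_p.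
  exists [ffun r => Ordinal (p_lt r)]; apply/andP; split.
    apply/forallP => r; apply/forallP => s; apply/implyP => lt_rs.
    by rewrite !ffunE /= (sorted_ltn_nth ltn_trans) ?inE ?size_p.
  apply/forallP => r; apply/forallP => s; rewrite !ffunE /= -!nth_t.
  have in_iota (i : 'I_(size sigma)) : val i \in iota 0 (size sigma).
    by rewrite mem_iota /=.
  exact: (allP (iso_t _ (in_iota r)) _ (in_iota s)).
Qed.

Lemma contains123P w :
  reflect (exists x y z, [/\ x < y, y < z & subseq [:: x; y; z] w])
          (contains w [:: 1; 2; 3]).
Proof.
apply: (iffP (containsP _ _)) => [[[|x [|y [|z []]]] //] | [x [y [z [? ? ?]]]]].
  by move=> ?; rewrite /order_iso /= => iso; exists x, y, z; split=> //; lia.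
by exists [:: x; y; z] => //; rewrite /order_iso /=; lia.
Qed.

Lemma contains213P w :
  reflect (exists x y z, [/\ y < x, x < z & subseq [:: x; y; z] w])
          (contains w [:: 2; 1; 3]).
Proof.
apply: (iffP (containsP _ _)) => [[[|x [|y [|z []]]] //] | [x [y [z [? ? ?]]]]].
  by move=> ?; rewrite /order_iso /= => iso; exists x, y, z; split=> //; lia.
by exists [:: x; y; z] => //; rewrite /order_iso /=; lia.
Qed.

Lemma contains231P w :
  reflect (exists x y z, [/\ z < x, x < y & subseq [:: x; y; z] w])
          (contains w [:: 2; 3; 1]).
Proof.
apply: (iffP (containsP _ _)) => [[[|x [|y [|z []]]] //] | [x [y [z [? ? ?]]]]].
  by move=> ?; rewrite /order_iso /= => iso; exists x, y, z; split=> //; lia.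
by exists [:: x; y; z] => //; rewrite /order_iso /=; lia.
Qed.

Lemma contains1221P w :
  reflect (exists x y, x < y /\ subseq [:: x; y; y; x] w)
          (contains w [:: 1; 2; 2; 1]).
Proof.
apply: (iffP (containsP _ _)) => [[[|x [|y [|y' [|x' []]]]] //] | [x [y [? ?]]]].
  move=> sub_w; rewrite /order_iso /= => iso.
  exists x, y; split; first by lia.
  have [Ex Ey] : x = x' /\ y = y' by lia.
  by move: sub_w; rewrite -Ex -Ey.
by exists [:: x; y; y; x] => //; rewrite /order_iso /=; lia.
Qed.

Lemma contains2112P w :
  reflect (exists x y, x < y /\ subseq [:: y; x; x; y] w)
          (contains w [:: 2; 1; 1; 2]).
Proof.
apply: (iffP (containsP _ _)) => [[[|y [|x [|x' [|y' []]]]] //] | [x [y [? ?]]]].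
  move=> sub_w; rewrite /order_iso /= => iso.
  exists x, y; split; first by lia.
  have [Ex Ey] : x = x' /\ y = y' by lia.
  by move: sub_w; rewrite -Ex -Ey.
by exists [:: y; x; x; y] => //; rewrite /order_iso /=; lia.
Qed.

(** * The letters above 1 decrease *)

Lemma sorted_geqP s :
  reflect (forall x y, subseq [:: x; y] s -> y <= x) (sorted geq s).
Proof.
rewrite sorted_pairwise; last by move=> y x z /= xy yz; exact: leq_trans yz xy.
apply: (iffP idP) => [s_desc x y sub_s | ].
  by have /= := subseq_pairwise sub_s s_desc; rewrite !andbT.
elim: s => //= h s IH le_s; apply/andP; split.
  by apply/allP => y s_y; apply: le_s; rewrite eqxx sub1seq.
by apply: IH => x y sub_s; apply: le_s; exact: subseq_trans sub_s (subseq_cons _ _).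
Qed.

Lemma not_uniq_subseq (T : eqType) (s : seq T) :
  ~~ uniq s -> exists y, subseq [:: y; y] s.
Proof.
elim: s => //= h s IH; rewrite negb_and negbK => /orP[s_h | /IH[y sub_s]].
  by exists h; rewrite eqxx sub1seq.
by exists y; exact: subseq_trans sub_s (subseq_cons _ _).
Qed.

Lemma subseq2_insert (T : eqType) (x y z : T) w :
  z != x -> z != y -> subseq [:: x; y] w -> z \in w ->
  [|| subseq [:: z; x; y] w, subseq [:: x; z; y] w | subseq [:: x; y; z] w].
Proof.
move=> zx zy.
have one u : y \in u -> z \in u -> subseq [:: z; y] u || subseq [:: y; z] u.
  elim: u => //= h u IH; rewrite !inE.
  have [yh _|hy] := eqVneq y h.
    by rewrite -yh (negbTE zy) /= !sub1seq => ->; rewrite orbT.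
  have [zh|hz] := eqVneq z h; last exact: IH.
  by rewrite /= !sub1seq => ->.
elim: w => //= h w IH; rewrite inE.
have [xh|xh] := eqVneq x h.
  rewrite -xh (negbTE zx) sub1seq => w_y /= w_z.
  by rewrite (one _ w_y w_z) orbT.
have [zh|hz] := eqVneq z h; last exact: IH.
by move=> /= ->.
Qed.

(** A 1 extends any ascent among the larger letters to one of the three
    patterns, and each of the patterns contains an ascent above its minimum. *)
Lemma avoids_three_sorted w :
  all (leq 1) w -> 1 \in w ->
  all (avoids w) [:: [:: 1; 2; 3]; [:: 2; 1; 3]; [:: 2; 3; 1]]
    = sorted geq [seq x <- w | x != 1].
Proof.
move=> /allP w_pos w_1; rewrite /= andbT /avoids; apply/idP/idP.
- case/and3P=> /contains123P no123 /contains213P no213 /contains231P no231.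
  apply/sorted_geqP => x y; rewrite subseq_filter => /andP[/= /and3P[x1 y1 _] sub_w].
  have [x_pos y_pos] : 0 < x /\ 0 < y.
    by split; apply/w_pos/(mem_subseq sub_w); rewrite !inE eqxx ?orbT.
  rewrite leqNgt; apply/negP => lt_xy.
  have n1x : 1 != x by rewrite eq_sym.
  have n1y : 1 != y by rewrite eq_sym.
  case/or3P: (subseq2_insert n1x n1y sub_w w_1) => sub3.
  + by case: no123; exists 1, x, y; split=> //; lia.
  + by case: no213; exists x, 1, y; split=> //; lia.
  + by case: no231; exists x, y, 1; split=> //; lia.
- move=> /sorted_geqP rest_desc.
  have no_ascent u x y : u \in w -> u < x -> x < y -> subseq [:: x; y] w -> False.
    move=> /w_pos u_pos u_x lt_xy sub_w; have := rest_desc x y.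
    by rewrite subseq_filter sub_w /= leqNgt lt_xy => /(_ ltac:(lia)).
  apply/and3P; split.
  + apply/contains123P => -[x [y [z [xy yz sub_w]]]].
    apply: (no_ascent x y z) => //; first by apply: (mem_subseq sub_w); rewrite inE eqxx.
    exact: subseq_trans (subseq_cons _ _) sub_w.
  + apply/contains213P => -[x [y [z [yx xz sub_w]]]].
    apply: (no_ascent y x z) => //; first by apply: (mem_subseq sub_w); rewrite !inE eqxx orbT.
    apply: subseq_trans sub_w; apply: (@cat_subseq _ [:: x] [:: z] [:: x] [:: y; z]) => //.
    exact: subseq_cons.
  + apply/contains231P => -[x [y [z [zx xy sub_w]]]].
    apply: (no_ascent z x y) => //; first by apply: (mem_subseq sub_w); rewrite !inE eqxx !orbT.
    exact: subseq_trans (prefix_subseq [:: x; y] [:: z]) sub_w.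
Qed.

(** * Where the two 1s may stand *)

(** The hypothesis on counts makes the displayed [x] on the left match the
    displayed [x] on the right: matching it later would leave too few copies of
    [x] in [B] for those in [s2]. *)
Lemma subseq_cut (T : eqType) (x : T) s1 s2 A B :
  x \notin s1 -> x \notin A -> count_mem x s2 = count_mem x B ->
  subseq (s1 ++ x :: s2) (A ++ x :: B) = subseq s1 A && subseq s2 B.
Proof.
move=> s1_x + Ecount; elim: A s1 s1_x => [|a A IH] [|h s1].
- by rewrite /= eqxx.
- rewrite inE negb_or eq_sym => /andP[/negbTE hx _] _ /=; rewrite hx.
  apply/negbTE/negP => /(leq_count_subseq (pred1 x)).
  by rewrite /= hx count_cat /= eqxx Ecount; lia.
- move=> nx; rewrite inE negb_or => /andP[/negbTE ax Ax] /=.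
  by rewrite ax -[x :: s2]/([::] ++ x :: s2) IH // sub0seq.
rewrite !inE !negb_or => /andP[hx s1_x] /andP[ax Ax] /=.
case: (h == a); first exact: IH.
by rewrite -[h :: s1 ++ _]/((h :: s1) ++ _) IH // inE negb_or hx.
Qed.

(** Because the letters above 1 decrease, the smaller letter of a nesting is 1,
    and its two copies are the two displayed ones. *)
Lemma avoids_nesting A B C :
  all (leq 2) (A ++ B ++ C) -> sorted geq (A ++ B ++ C) ->
  avoids (A ++ 1 :: B ++ 1 :: C) [:: 1; 2; 2; 1] &&
    avoids (A ++ 1 :: B ++ 1 :: C) [:: 2; 1; 1; 2]
  = uniq B && ~~ has (mem A) C.
Proof.
set w := A ++ 1 :: _ => D_ge2 /sorted_geqP D_desc.
have D_no1 : 1 \notin A ++ B ++ C by apply/negP => /(allP D_ge2).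
have [/negbTE A1 [/negbTE B1 /negbTE C1]] : 1 \notin A /\ 1 \notin B /\ 1 \notin C.
  by move: D_no1; rewrite !mem_cat !negb_or => /and3P[].
have rest_w : [seq v <- w | v != 1] = A ++ B ++ C.
  rewrite /w filter_cat /= filter_cat /= -!filter_cat.
  by apply/all_filterP/allP => v /(allP D_ge2); lia.
have cntB : count_mem 1 B = 0 by apply/count_memPn; rewrite B1.
have cntC : count_mem 1 C = 0 by apply/count_memPn; rewrite C1.
have lowest x y u : x < y -> subseq [:: x; y] u -> subseq u w -> x = 1.
  move=> lt_xy sub_u u_w; have sub_w := subseq_trans sub_u u_w.
  apply/eqP; apply: contraT => x1.
  have x_ge2 : 1 < x.
    apply: (allP D_ge2); rewrite -rest_w mem_filter x1.
    by apply: (mem_subseq sub_w); rewrite inE eqxx.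
  have := D_desc x y.
  by rewrite -rest_w subseq_filter sub_w /= leqNgt lt_xy => /(_ ltac:(lia)).
have sub1221 y : y != 1 -> subseq [:: 1; y; y; 1] w = subseq [:: y; y] B.
  move=> y1; rewrite /w (@subseq_cut _ 1 [::] [:: y; y; 1]) ?A1 //; last first.
    by rewrite /= (negbTE y1) count_cat /= cntB cntC.
  rewrite sub0seq (@subseq_cut _ 1 [:: y; y] [::]) ?B1 ?cntC // ?sub0seq ?andbT //.
  by rewrite !inE !(eq_sym 1) !(negbTE y1).
have sub2112 y : y != 1 -> subseq [:: y; 1; 1; y] w = (y \in A) && (y \in C).
  move=> y1; rewrite /w (@subseq_cut _ 1 [:: y] [:: 1; y]) ?A1 //; first last.
  - by rewrite /= (negbTE y1) count_cat /= cntB cntC.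
  - by rewrite inE eq_sym.
  rewrite (@subseq_cut _ 1 [::] [:: y]) ?B1 //; first by rewrite !sub1seq sub0seq.
  by rewrite /= (negbTE y1) cntC.
rewrite /avoids; congr andb.
- apply/idP/idP => [/contains1221P no1221 | uniqB].
    apply: contraT => /not_uniq_subseq[y yyB]; case: no1221; exists 1, y.
    have y_ge2 : 1 < y.
      by apply: (allP D_ge2); rewrite !mem_cat (mem_subseq yyB) ?inE ?eqxx ?orbT.
    by split=> //; rewrite sub1221 //; lia.
  apply/contains1221P => -[x [y [lt_xy sub_w]]].
  have x1 : x = 1.
    by apply: lowest lt_xy _ sub_w; exact: (prefix_subseq [:: x; y] [:: y; x]).
  move: sub_w; rewrite x1 in lt_xy *; rewrite sub1221; last by lia.
  by move=> /subseq_uniq/(_ uniqB); rewrite /= inE eqxx.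
- apply/idP/idP => [/contains2112P no2112 | disj].
    apply/hasP => -[y C_y /= A_y]; case: no2112; exists 1, y.
    have y_ge2 : 1 < y by apply: (allP D_ge2); rewrite !mem_cat C_y !orbT.
    by split=> //; rewrite sub2112 ?C_y ?[_ \in A]A_y //; lia.
  apply/contains2112P => -[x [y [lt_xy sub_w]]].
  have x1 : x = 1.
    by apply: lowest lt_xy _ sub_w; exact: (suffix_subseq [:: y; x] [:: x; y]).
  move: sub_w; rewrite x1 in lt_xy *; rewrite sub2112; last by lia.
  by case/andP=> A_y C_y; case/hasP: disj; exists y.
Qed.

Fixpoint descent (m : nat) : seq nat :=
  if m is k.+1 then k.+2 :: k.+2 :: descent k else [::].

Lemma size_descent m : size (descent m) = m.*2.
Proof. by elim: m => //= m ->; rewrite doubleS. Qed.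

Lemma nth_descent m i : i < m.*2 -> nth 0 (descent m) i = m.+1 - i./2.
Proof.
elim: m i => //= m IH [|[|i]] //=; try lia.
by rewrite doubleS !ltnS => /IH ->; lia.
Qed.

Lemma descent_range m : all (fun x => 2 <= x <= m.+1) (descent m).
Proof.
elim: m => //= m IH; rewrite !ltnS leqnn /=.
by apply: sub_all IH => x; lia.
Qed.

Lemma descent_sorted m : sorted geq (descent m).
Proof.
elim: m => //= m IH; rewrite leqnn /= (path_sortedE); last first.
  by move=> y x z /= xy yz; exact: leq_trans yz xy.
rewrite IH andbT; apply: sub_all (descent_range m) => x /=; lia.
Qed.

Lemma doubled_perm m : perm_eq (doubled m.+1) (1 :: 1 :: descent m).
Proof.
elim: m => // m IH.
have -> : doubled m.+2 = doubled m.+1 ++ [:: m.+2; m.+2].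
  by rewrite /doubled -[in LHS](addn1 m.+1) iotaD map_cat flatten_cat /= add1n.
apply: perm_trans (perm_cat IH (perm_refl _)) _.
by apply/permP => P; rewrite count_cat /=; lia.
Qed.

Lemma sorted_perm_descent m s :
  perm_eq s (descent m) -> sorted geq s -> s = descent m.
Proof.
move=> eq_s s_desc; apply: (sorted_eq (leT := geq)) => //.
- by move=> y x z /= xy yz; exact: leq_trans yz xy.
- by move=> x y /andP[/= xy yx]; apply/eqP; rewrite eqn_leq xy yx.
- exact: descent_sorted.
Qed.

(** The second 1 is placed relative to the first, because the nesting condition
    depends on the distance between them and on the parity of [p.1] only. *)
Definition insert1s (D : seq nat) (p : nat * nat) : seq nat :=
  take p.1 D ++ 1 :: take p.2 (drop p.1 D) ++ 1 :: drop p.2 (drop p.1 D).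

Definition nonnesting_slot (p : nat * nat) : bool :=
  [|| (p.2 == 0) && ~~ odd p.1, p.2 == 1 | (p.2 == 2) && odd p.1].

(** Three consecutive letters of the descent contain an equal pair, and two do
    when they start at an even position. *)
Lemma uniq_block m a l : a + l <= m.*2 ->
  uniq (take l (drop a (descent m))) = (l <= 1) || (l == 2) && odd a.
Proof.
move=> le_al.
have size_block : size (take l (drop a (descent m))) = l.
  by rewrite size_takel // size_drop size_descent; lia.
have nth_block i : i < l ->
    nth 0 (take l (drop a (descent m))) i = m.+1 - (a + i)./2.
  by move=> lt_i; rewrite nth_take // nth_drop nth_descent; lia.
apply/idP/idP => [/(uniqP 0) inj | ok].
  apply: contraT => bad; have [i [lt_i eq_i]] : exists i, i.+1 < l /\ (a + i)./2 = (a + i.+1)./2.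
    (* The first full pair of the block starts at the first even position. *)
    by exists (odd a); lia.
  have := inj i i.+1; rewrite !inE size_block !nth_block ?(ltnW lt_i) // eq_i.
  by move=> /(_ isT lt_i erefl); lia.
apply/(uniqP 0) => i j; rewrite !inE size_block => lt_i lt_j.
by rewrite !nth_block //; lia.
Qed.

(** A letter lies on both sides of the block only if the block is empty and cuts
    an equal pair in the middle. *)
Lemma disjoint_block m a l : a + l <= m.*2 ->
  ~~ has (mem (take a (descent m))) (drop l (drop a (descent m)))
    = ~~ (odd a && (l == 0)).
Proof.
move=> le_al; congr negb; rewrite drop_drop.
have size_pre : size (take a (descent m)) = a by rewrite size_takel // size_descent; lia.
apply/hasP/idP => [[y] | /andP[odd_a /eqP l0]].
  move=> /(nthP 0)[i]; rewrite size_drop size_descent => lt_i.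
  rewrite nth_drop nth_descent => [<-|]; last by lia.
  move=> /(nthP 0)[j]; rewrite size_pre => lt_j.
  by rewrite nth_take // nth_descent; lia.
rewrite l0 in le_al *; exists (m.+1 - a./2).
  apply/(nthP 0); exists 0; first by rewrite size_drop size_descent; lia.
  by rewrite nth_drop nth_descent; lia.
apply/(nthP 0); exists a.-1; first by rewrite size_pre; lia.
by rewrite nth_take ?nth_descent; lia.
Qed.

Lemma insert1s_nonnesting m p : p.1 + p.2 <= m.*2 ->
  avoids (insert1s (descent m) p) [:: 1; 2; 2; 1] &&
    avoids (insert1s (descent m) p) [:: 2; 1; 1; 2] = nonnesting_slot p.
Proof.
move=> le_p; rewrite avoids_nesting ?cat_take_drop ?descent_sorted //.
  rewrite uniq_block // disjoint_block // /nonnesting_slot.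
  by case: (odd p.1); case: p.2 => [|[|[|]]].
by apply: sub_all (descent_range m) => x /andP[].
Qed.

Lemma insert1s_perm D p : perm_eq (insert1s D p) (1 :: 1 :: D).
Proof.
apply/permP => P; rewrite -[in RHS](cat_take_drop p.1 D).
rewrite -[in RHS](cat_take_drop p.2 (drop p.1 D)) /insert1s.
by rewrite /= !count_cat /= !count_cat /=; lia.
Qed.

Lemma insert1s_rest D p :
  1 \notin D -> [seq v <- insert1s D p | v != 1] = D.
Proof.
move=> D1; rewrite /insert1s filter_cat /= filter_cat /= -!filter_cat.
rewrite !cat_take_drop; apply/all_filterP.
by rewrite all_predC has_pred1.
Qed.

(** The data are read off as the positions of the first 1 and then of the
    next one. *)
Lemma insert1s_inj (D : seq nat) : 1 \notin D ->
  {in [pred p | p.1 + p.2 <= size D] &, injective (insert1s D)}.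
Proof.
move=> D1 [a l] [a' l']; rewrite !inE /= => le_p le_p' eq_w.
have idx b u : b <= size D -> index 1 (take b D ++ 1 :: u) = b.
  move=> le_b; rewrite index_cat /= addn0 size_takel //.
  by case: ifP => // /mem_take; rewrite (negbTE D1).
have [le_a le_a'] : a <= size D /\ a' <= size D.
  by split; [exact: leq_trans (leq_addr l a) le_p | exact: leq_trans (leq_addr l' a') le_p'].
have a_eq : a = a' by move: (congr1 (index 1) eq_w); rewrite /insert1s /= !idx.
rewrite -a_eq in le_p' eq_w *; move: eq_w; rewrite /insert1s /= => /(congr1 (drop a.+1)).
have tail u : drop a.+1 (take a D ++ 1 :: u) = u.
  by rewrite -cat_rcons drop_size_cat // size_rcons size_takel.
have idx2 b u : a + b <= size D -> index 1 (take b (drop a D) ++ 1 :: u) = b.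
  move=> le_b; rewrite index_cat /= addn0 size_takel ?size_drop ?leq_subRL //.
  by case: ifP => // /mem_take/mem_drop; rewrite (negbTE D1).
by rewrite !tail => /(congr1 (index 1)); rewrite !idx2 // => ->.
Qed.

Lemma split_two_ones w : count_mem 1 w = 2 ->
  exists2 p, p.1 + p.2 <= size [seq v <- w | v != 1] &
    w = insert1s [seq v <- w | v != 1] p.
Proof.
have split1 u k : count_mem 1 u = k.+1 ->
    exists A v, [/\ u = A ++ 1 :: v, [seq x <- A | x != 1] = A & count_mem 1 v = k].
  move=> cnt; have u_1 : 1 \in u by rewrite -has_pred1 has_count cnt.
  pose A := take (index 1 u) u; pose v := drop (index 1 u).+1 u.
  have def_u : u = A ++ 1 :: v.
    by rewrite -[in LHS](cat_take_drop (index 1 u) u) (drop_nth 0) ?index_mem // nth_index.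
  have A1 : 1 \notin A by apply/negP => /index_ltn; rewrite ltnn.
  exists A, v; split=> //; first by apply/all_filterP; rewrite all_predC has_pred1.
  by move: cnt; rewrite def_u count_cat /= (count_memPn A1); lia.
case/split1=> A [u [-> fA /split1[B [C [-> fB cntC]]]]].
have fC : [seq x <- C | x != 1] = C.
  by apply/all_filterP; rewrite all_predC has_pred1; apply/count_memPn.
exists (size A, size B).
  by rewrite !(filter_cat, size_cat) /= !(filter_cat, size_cat) /= fA fB; lia.
rewrite !filter_cat /= filter_cat /= fA fB fC /insert1s /=.
by rewrite drop_size_cat // !take_size_cat // drop_size_cat.
Qed.

(** * Counting *)

(** Grouping by the distance between the two 1s makes the three cardinals
    [m.+1], [m.*2] and [m.-1] visible. *)
Definition slots (m : nat) : seq (nat * nat) :=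
  [seq (k.*2, 0) | k <- iota 0 m.+1] ++ [seq (k, 1) | k <- iota 0 m.*2] ++
  [seq (k.*2.+1, 2) | k <- iota 0 m.-1].

Lemma mem_slots m p : (p \in slots m) = (p.1 + p.2 <= m.*2) && nonnesting_slot p.
Proof.
case: p => a l; rewrite /slots !mem_cat /nonnesting_slot; apply/idP/andP => [|[le_al ok]].
  by case/or3P=> /mapP[k]; rewrite mem_iota => hk [-> ->] /=; lia.
rewrite /= in le_al ok; have [l0 | [l1 | l2]] : l = 0 \/ l = 1 \/ l = 2 by lia.
- apply/or3P; apply: Or31; apply/mapP; exists a./2; first by rewrite mem_iota; lia.
  by congr pair; lia.
- by apply/or3P; apply: Or32; apply/mapP; exists a; rewrite ?l1 // mem_iota; lia.
- apply/or3P; apply: Or33; apply/mapP; exists a./2; first by rewrite mem_iota; lia.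
  by congr pair; lia.
Qed.

Lemma uniq_slots m : uniq (slots m).
Proof.
rewrite /slots !cat_uniq !map_inj_uniq ?iota_uniq; first last.
- by move=> k k' [/double_inj].
- by move=> k k' [].
- by move=> k k' [/double_inj].
rewrite andbT !andTb; apply/andP; split; apply/hasPn => p.
  by rewrite mem_cat => /orP[]/mapP[k _ ->]; apply/negP => /mapP[].
by move=> /mapP[k _ ->]; apply/negP => /mapP[].
Qed.

Lemma size_slots m : 0 < m -> size (slots m) = 4 * m.
Proof. by rewrite /slots !size_cat !size_map !size_iota; lia. Qed.

(** The 1-free part of a counted word is a decreasing rearrangement of the
    descent, hence the descent itself; only the places of the 1s are free. *)
Lemma mem_counted m w :
  (w \in [seq w <- nonnesting m.+1 |
     all (avoids w) [:: [:: 1; 2; 3]; [:: 2; 1; 3]; [:: 2; 3; 1]]])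
  = (w \in [seq insert1s (descent m) p | p <- slots m]).
Proof.
have D1 : 1 \notin descent m by apply/negP => /(allP (descent_range m)).
rewrite !mem_filter mem_permutations (perm_sym w) (permPl (doubled_perm m)).
rewrite perm_sym.
have [perm_w | not_perm] := boolP (perm_eq w _); last first.
  rewrite !andbF; apply/esym/mapP => -[p _ def_w].
  by rewrite def_w insert1s_perm in not_perm.
have w_1 : 1 \in w by rewrite (perm_mem perm_w) inE eqxx.
have w_pos : all (leq 1) w.
  rewrite (perm_all _ perm_w) /=.
  by apply: sub_all (descent_range m) => x /andP[/ltnW].
have rest_perm : perm_eq [seq v <- w | v != 1] (descent m).
  apply: perm_trans (perm_filter _ perm_w) _; rewrite /=.
  by rewrite (all_filterP _) // all_predC has_pred1.
rewrite avoids_three_sorted // andbT; apply/andP/mapP => [[rest_desc avoid_w] | [p]].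
  have rest_w := sorted_perm_descent rest_perm rest_desc.
  have cnt_w : count_mem 1 w = 2.
    by rewrite (permP perm_w) /= (count_memPn D1).
  case: (split_two_ones cnt_w) => p; rewrite rest_w size_descent => le_p def_w.
  by exists p => //; rewrite mem_slots le_p -(insert1s_nonnesting le_p) -def_w.
rewrite mem_slots => /andP[le_p ok_p] ->.
by rewrite insert1s_rest // descent_sorted insert1s_nonnesting.
Qed.

Theorem theorem2p15 (n : nat) (hn : 2 <= n) :
  c n [:: [:: 1; 2; 3]; [:: 2; 1; 3]; [:: 2; 3; 1]] = 4 * (n - 1).
Proof.
case: n hn => // m; rewrite ltnS subSS subn0 => m_gt0.
rewrite -(size_slots m_gt0) -(size_map (insert1s (descent m))).
apply/perm_size/uniq_perm; last exact: mem_counted.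
  by rewrite !filter_uniq // permutations_uniq.
rewrite map_inj_in_uniq ?uniq_slots // => p q; rewrite !mem_slots.
move=> /andP[le_p _] /andP[le_q _]; apply: insert1s_inj; rewrite ?inE ?size_descent //.
by apply/negP => /(allP (descent_range m)).
Qed.
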